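(* Let $k$ be an algebraically closed field and $A$ a finite-dimensional unital associative $k$-algebra. The lattice $\mathcal{L}_t(A)$ of pretorsion classes of $\mathrm{mod}\,A$ is distributive if and only if $\mathrm{add}(\mathcal{T}_1\cup\mathcal{T}_2)=\mathrm{Gen}(\mathcal{T}_1\cup\mathcal{T}_2)$ for every pair of pretorsion classes $\mathcal{T}_1$ and $\mathcal{T}_2$ in $\mathcal{L}_t(A)$.
   Context: $\mathrm{mod}\,A$ is the category of finitely generated right $A$-modules. All subcategories are full and closed under isomorphisms. A pretorsion class of $\mathrm{mod}\,A$ is a subcategory containing $0$ and closed under quotients and finite direct sums. $\mathcal{L}_t(A)$ is the set of pretorsion classes of $\mathrm{mod}\,A$ ordered by inclusion; it is a complete lattice with meet $\mathcal{T}_1\cap\mathcal{T}_2$ and join $\mathrm{Gen}(\mathcal{T}_1\cup\mathcal{T}_2)$. For a class $\mathcal{S}$ of modules, $\mathrm{Gen}(\mathcal{S})$ is the smallest pretorsion class containing $\mathcal{S}$, i.e. the subcategory of all quotients of finite direct sums of modules in $\mathcal{S}$, and $\mathrm{add}(\mathcal{S})$ is the subcategory of modules isomorphic to finite direct sums of modules in $\mathcal{S}$. *)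

(* Defs.v *)
From HB Require Import structures.
From mathcomp Require Import all_boot all_order all_algebra.
From mathcomp Require Import boolp.

Set Implicit Arguments.
Unset Strict Implicit.
Unset Printing Implicit Defensive.

Import GRing.Theory.

Local Open Scope ring_scope.

(* Right A-modules are left modules over the converse ring A^c: x *: m for
   x : A^c stands for m x. *)
Notation rmodType A := (lmodType A^c).

(* Classes of modules are bare predicates, and the lattice structure below is
   given by explicit operations: for universe reasons the types set and
   latticeType of the libraries cannot be used over the large type rmodType A. *)
Definition module_class (A : pzRingType) := rmodType A -> Prop.

Definition subclass A (S T : module_class A) : Prop := forall M, S M -> T M.

Definition unionclass A (S T : module_class A) : module_class A :=
  fun M => S M \/ T M.

Definition interclass A (S T : module_class A) : module_class A :=
  fun M => S M /\ T M.

Section Modules.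
Variable A : pzRingType.
Implicit Types M N P : rmodType A.
Implicit Types S T : module_class A.

Definition fingen M : Prop :=
  exists (n : nat) (g : 'I_n -> M),
    forall m, exists c : 'I_n -> A^c, m = \sum_i c i *: g i.

Definition is_quotient M N : Prop :=
  exists f : {linear M -> N}, forall y, exists x, f x = y.

Definition is_isomorphic M N : Prop :=
  exists f : {linear M -> N}, bijective f.

Definition zero_module : rmodType A := 'rV[A^c]_0.

Definition direct_sum2 M N : rmodType A := (M * N)%type.

(* The modules M1 * (M2 * ( ... * (Mn * 0))) with n >= 0 and every Mi in S. *)
Inductive direct_sum S : rmodType A -> Prop :=
| direct_sum_nil : direct_sum S zero_module
| direct_sum_cons M N :
    S M -> direct_sum S N -> direct_sum S (direct_sum2 M N).

Definition addm S : module_class A :=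
  fun N => exists2 M, direct_sum S M & is_isomorphic M N.

Definition Gen S : module_class A :=
  fun N => exists2 M, direct_sum S M & is_quotient M N.

(* Closure under isomorphism is the special case of closure under quotients. *)
Record is_pretorsion T : Prop := IsPretorsion {
  pretorsion_fingen : subclass T fingen;
  pretorsion_zero : T zero_module;
  pretorsion_sum : subclass (direct_sum T) T;
  pretorsion_quotient : forall M N, T M -> is_quotient M N -> T N }.

Lemma linear_pack M N (f : M -> N) :
  linear f -> exists g : {linear M -> N}, g =1 f.
Proof.
move=> lf; pose F := GRing.isLinear.Build _ M N _ f lf.
pose g : {linear M -> N} := HB.pack f F.
by exists g.
Qed.

Lemma is_quotient_refl M : is_quotient M M.
Proof. by exists idfun => y; exists y. Qed.

Lemma is_quotient_trans M N P :
  is_quotient M N -> is_quotient N P -> is_quotient M P.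
Proof.
case=> f fS [g gS]; exists (g \o f) => z.
by have [y <-] := gS z; have [x <-] := fS y; exists x.
Qed.

Lemma is_isomorphic_quotient M N : is_isomorphic M N -> is_quotient M N.
Proof. by case=> f [g _ gK]; exists f => y; exists (g y). Qed.

Lemma is_quotient_sum M M' N N' : is_quotient M M' -> is_quotient N N' ->
  is_quotient (direct_sum2 M N) (direct_sum2 M' N').
Proof.
case=> f fS [g gS].
have [|h hE] := @linear_pack (direct_sum2 M N) (direct_sum2 M' N')
  (fun z => (f z.1, g z.2)).
  by move=> a [x1 x2] [y1 y2]; rewrite /= !linearP.
exists h => -[y1 y2]; have [x1 fx1] := fS y1; have [x2 gx2] := gS y2.
by exists (x1, x2); rewrite hE /= fx1 gx2.
Qed.

Lemma is_quotient_sumA M N P :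
  is_quotient (direct_sum2 M (direct_sum2 N P))
              (direct_sum2 (direct_sum2 M N) P).
Proof.
have [|h hE] := @linear_pack (direct_sum2 M (direct_sum2 N P))
    (direct_sum2 (direct_sum2 M N) P) (fun z => ((z.1, z.2.1), z.2.2)).
  by [].
by exists h => -[[x y] z]; exists (x, (y, z)); rewrite hE.
Qed.

Lemma is_quotient_sum0 M : is_quotient M (direct_sum2 zero_module M).
Proof.
have [|h hE] := @linear_pack M (direct_sum2 zero_module M)
    (fun x => (0, x)).
  by move=> a x y; congr pair; rewrite [RHS](thinmx0 _).
by exists h => -[z x]; exists x; rewrite hE (thinmx0 z).
Qed.

Lemma is_quotient_proj1 M N : is_quotient (direct_sum2 M N) M.
Proof.
have [//|h hE] := @linear_pack (direct_sum2 M N) M (fun z => z.1).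
by exists h => x; exists (x, 0); rewrite hE.
Qed.

Lemma fingen_zero : fingen zero_module.
Proof.
by exists 0%N, (fun=> 0) => m; exists (fun=> 0); rewrite big_ord0 (thinmx0 m).
Qed.

Lemma fingen_quotient M N : fingen M -> is_quotient M N -> fingen N.
Proof.
case=> n [g gP] [f fS]; exists n, (f \o g) => y.
have [x <-] := fS y; have [c ->] := gP x; exists c.
by rewrite linear_sum; apply: eq_bigr => i _; rewrite linearZ.
Qed.

Lemma fingen_sum M N : fingen M -> fingen N -> fingen (direct_sum2 M N).
Proof.
case=> m [g gP] [n [h hP]].
exists (m + n)%N, (fun i => match split i with
  inl i => (g i, 0) | inr j => (0, h j) end : direct_sum2 M N) => -[x y].
have [c ->] := gP x; have [d ->] := hP y.
exists (fun i => match split i with inl i => c i | inr j => d j end).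
have sl i : split (lshift n i) = inl i := unsplitK (inl i).
have sr j : split (rshift m j) = inr j := unsplitK (inr j).
rewrite [RHS]surjective_pairing; congr pair.
  rewrite (linear_sum fst) big_split_ord /= [X in _ = _ + X]big1 ?addr0.
    by apply: eq_bigr => i _; rewrite sl.
  by move=> j _; rewrite sr /= scaler0.
rewrite (linear_sum snd) big_split_ord /= [X in _ = X + _]big1 ?add0r.
  by apply: eq_bigr => j _; rewrite sr.
by move=> i _; rewrite sl /= scaler0.
Qed.

Lemma direct_sumW S T M : subclass S T -> direct_sum S M -> direct_sum T M.
Proof.
by move=> ST; elim=> [|{}M N SM _ TN]; constructor => //; apply: ST.
Qed.

Lemma direct_sum_fingen S M :
  subclass S fingen -> direct_sum S M -> fingen M.
Proof.
move=> Sfg; elim=> [|{}M N SM _ fN]; first exact: fingen_zero.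
exact: fingen_sum (Sfg _ SM) fN.
Qed.

Lemma direct_sum_cat S M N : direct_sum S M -> direct_sum S N ->
  exists2 P, direct_sum S P & is_quotient P (direct_sum2 M N).
Proof.
move=> + SN; elim=> [|{}M M' SM _ [P SP PQ]].
  by exists N => //; apply: is_quotient_sum0.
exists (direct_sum2 M P); first by constructor.
exact: is_quotient_trans (is_quotient_sum (is_quotient_refl M) PQ)
  (is_quotient_sumA _ _ _).
Qed.

Lemma sub_Gen S : subclass S (Gen S).
Proof.
move=> M SM; exists (direct_sum2 M zero_module).
  by constructor => //; constructor.
exact: is_quotient_proj1.
Qed.

Lemma Gen_pretorsion S : subclass S fingen -> is_pretorsion (Gen S).
Proof.
move=> Sfg; split.
- move=> N [M SM MN]; exact: fingen_quotient (direct_sum_fingen Sfg SM) MN.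
- by exists zero_module; [constructor | apply: is_quotient_refl].
- move=> M; elim=> [|{}M N [P SP PM] _ [Q SQ QN]].
    by exists zero_module; [constructor | apply: is_quotient_refl].
  have [U SU UPQ] := direct_sum_cat SP SQ; exists U => //.
  exact: is_quotient_trans UPQ (is_quotient_sum PM QN).
- move=> M N [P SP PM] MN; exists P => //; exact: is_quotient_trans PM MN.
Qed.

Lemma Gen_min S T : is_pretorsion T -> subclass S T -> subclass (Gen S) T.
Proof.
move=> Tp ST N [M SM MN]; apply: pretorsion_quotient MN => //.
by apply: pretorsion_sum => //; apply: direct_sumW SM.
Qed.

Lemma is_pretorsionI S T :
  is_pretorsion S -> is_pretorsion T -> is_pretorsion (interclass S T).
Proof.
move=> Sp Tp; split.
- by move=> M [SM _]; apply: pretorsion_fingen SM.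
- by split; apply: pretorsion_zero.
- move=> M STM; split.
    by apply: pretorsion_sum => //; apply: direct_sumW STM => ? [].
  by apply: pretorsion_sum => //; apply: direct_sumW STM => ? [].
- by move=> M N [SM TM] MN; split; apply: pretorsion_quotient MN.
Qed.

End Modules.

Record pretorsion (A : pzRingType) : Type := Pretorsion {
  pretorsion_class :> module_class A;
  pretorsionP : is_pretorsion pretorsion_class }.

Section Lattice.
Variable A : pzRingType.
Implicit Types T : pretorsion A.

Fact pretorsion_union_fingen T1 T2 : subclass (unionclass T1 T2) (@fingen A).
Proof. by move=> M []; apply: pretorsion_fingen (pretorsionP _) _. Qed.

Definition pretorsion_meet T1 T2 : pretorsion A :=
  Pretorsion (is_pretorsionI (pretorsionP T1) (pretorsionP T2)).

Definition pretorsion_join T1 T2 : pretorsion A :=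
  Pretorsion (Gen_pretorsion (@pretorsion_union_fingen T1 T2)).

Lemma pretorsion_anti T1 T2 : subclass T1 T2 -> subclass T2 T1 -> T1 = T2.
Proof.
case: T1 T2 => [T1 p1] [T2 p2] /= T12 T21.
have E : T1 = T2.
  by apply: funext => M; apply: propext; split; [apply: T12 | apply: T21].
by case: T2 / E {T12 T21} p2 => p2; congr Pretorsion; apply: Prop_irrelevance.
Qed.

Lemma pretorsion_meetP T1 T2 T3 :
  subclass T1 (pretorsion_meet T2 T3) <-> subclass T1 T2 /\ subclass T1 T3.
Proof.
split=> [T123|[T12 T13] M T1M]; first by split=> M /T123 [].
by split; [apply: T12 | apply: T13].
Qed.

Lemma pretorsion_joinP T1 T2 T3 :
  subclass (pretorsion_join T1 T2) T3 <-> subclass T1 T3 /\ subclass T2 T3.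
Proof.
split=> [T123|[T13 T23]].
  by split=> M TM; apply: T123; apply: sub_Gen; [left|right].
by apply: (Gen_min (pretorsionP T3)) => M [/T13|/T23].
Qed.

End Lattice.

(* Main.v *)
(* If add = Gen, a module in (T1 v T2) ^ T3 is a direct sum of modules of T1
   and T2, each a quotient of it and so in T3. Conversely, by induction on
   dimension it suffices to place an indecomposable M of T1 v T2 in T1 or T2.
   Distributivity applied to Gen(M) writes M as a sum of images of
   endomorphisms, each factoring through a module of T1 or T2. By Fitting,
   End(M) is local, so if none of these endomorphisms were surjective then
   M = rad(End(M)) M, against Nakayama. *)
Require Import Defs.
From HB Require Import structures.
From mathcomp Require Import all_boot all_order all_algebra all_field.
From mathcomp Require Import boolp.

Set Implicit Arguments.
Unset Strict Implicit.
Unset Printing Implicit Defensive.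

Import GRing.Theory.
Local Open Scope ring_scope.

(** * Direct summands cut out by idempotents *)

Section FixedPoints.
Variables (R : pzRingType) (M : lmodType R) (e : {linear M -> M}).

(** For idempotent [e] this is the image of [e], written as an equation so that membership is
    boolean and a subtype can be formed. *)
Definition fixed : {pred M} := [pred x | e x == x].

Fact fixed_submod_closed : submod_closed fixed.
Proof.
split=> [|a x y]; rewrite !inE ?linear0 //.
by move=> /eqP ex /eqP ey; rewrite linearP ex ey.
Qed.
HB.instance Definition _ :=
  GRing.isSubmodClosed.Build R M fixed fixed_submod_closed.

Record fixed_sub := FixedSub { fixed_val : M; _ : fixed_val \in fixed }.
HB.instance Definition _ := [isSub for fixed_val].
HB.instance Definition _ := [Choice of fixed_sub by <:].
HB.instance Definition _ := [SubChoice_isSubLmodule of fixed_sub by <:].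

Lemma fixed_valP (x : fixed_sub) : e (val x) = val x.
Proof. by apply/eqP; case: x. Qed.

End FixedPoints.

Section Splitting.
Variables (R : pzRingType) (M : lmodType R) (e : {linear M -> M}).
Hypothesis e_idem : forall x, e (e x) = e x.

Let e' : {linear M -> M} := idfun \- e.

(** The map adds the two components; its inverse is [x] to [(e x, x - e x)], because [e] kills the
    fixed points of [1 - e]. *)
Lemma idempotent_split :
  exists f : {linear (fixed_sub e * fixed_sub e')%type -> M}, bijective f.
Proof.
pose S : lmodType R := (fixed_sub e * fixed_sub e')%type.
pose f (z : S) := val z.1 + val z.2.
have lf : linear f by move=> a x y; rewrite /f !linearP scalerDr addrACA.
pose F := GRing.isLinear.Build _ S M _ f lf.
pose g : {linear S -> M} := HB.pack f F.
exists g.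
have ex x : e x \in fixed e by rewrite inE e_idem.
have e'x x : e' x \in fixed e' by rewrite inE /= linearB /= e_idem subrr subr0.
exists (fun x => (Sub (e x) (ex x), Sub (e' x) (e'x x)) : S).
  case=> x y; rewrite /g /= /f /=.
  have ey : e (val y) = 0.
    have /eqP := fixed_valP y.
    by rewrite /= subr_eq addrC -subr_eq subrr => /eqP.
  congr pair; apply: val_inj; rewrite !SubK.
    by rewrite linearD fixed_valP /= ey addr0.
  by rewrite /= linearD fixed_valP /= ey addr0 addrC addKr.
by move=> x; rewrite /g /= /f /= addrC subrK.
Qed.

End Splitting.

(** * Local endomorphism rings and Nakayama's lemma *)

Definition surj (T U : Type) (f : T -> U) : Prop := forall y, exists x, f x = y.

Lemma inj_surj_bij (T U : Type) (f : T -> U) :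
  injective f -> surj f -> bijective f.
Proof.
by move=> fI /choice[g gK]; exists g => // x; apply: fI; rewrite gK.
Qed.

Lemma linear_inverse (R : pzRingType) (M N : lmodType R) (f : {linear M -> N}) :
  bijective f -> exists2 g : {linear N -> M}, cancel f g & cancel g f.
Proof.
case=> g fK gK; pose F := GRing.isLinear.Build _ N M _ g (can2_linear fK gK).
by pose h : {linear N -> M} := HB.pack g F; exists h.
Qed.

Section LocalEndomorphisms.
Variables (R : pzRingType) (M : lmodType R).
Implicit Types f g : {linear M -> M}.

Hypothesis fitting :
  forall f, bijective f \/ exists n, forall x, iter n f x = 0.
Variable x0 : M.
Hypothesis x0_neq0 : x0 <> 0.

(** An injective map is not nilpotent on a nonzero module, so the first alternative of [fitting]
    holds. *)
Lemma inj_endo_bij f : injective f -> bijective f.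
Proof.
move=> fI; have [//|[n fn]] := fitting f; case: x0_neq0.
have : iter n f x0 = iter n f 0 by rewrite !fn.
by elim: n {fn} => //= n IH /fI.
Qed.

Lemma surj_endo_bij f : surj f -> bijective f.
Proof.
move=> fS; have [//|[n fn]] := fitting f; case: x0_neq0.
have [x <-] : exists x, iter n f x = x0; last exact: fn.
elim: n x0 {fn} => [|n IH] y; first by exists y.
by have [z <-] := fS y; have [x <-] := IH z; exists x.
Qed.

(** A non-surjective [f] is nilpotent by [fitting], so [z = f z] gives [z = iter n f z = 0]; thus
    [1 - f] is injective, hence bijective. *)
Lemma sub1_nonsurj_bij f : ~ surj f -> bijective (idfun \- f).
Proof.
move=> fS; have [[g _ gK]|[n fn]] := fitting f.
  by case: fS => y; exists (g y).
have inj0 z : z - f z = 0 -> z = 0.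
  move=> /eqP; rewrite subr_eq0 => /eqP zE; rewrite -(fn z).
  by elim: n {fn} => //= n <-.
apply: inj_endo_bij => x y /= /eqP; rewrite -subr_eq0 => /eqP E.
by apply: subr0_eq; apply: inj0; rewrite -{}E linearB !opprD !opprK addrACA.
Qed.

(** This makes End(M) local. If [h] inverts [f + g], then [h f] is not surjective, so
    [h g = 1 - h f] is bijective and [g] would be surjective. *)
Lemma nonsurj_add f g : ~ surj f -> ~ surj g -> ~ surj (f \+ g).
Proof.
move=> fS gS /surj_endo_bij/linear_inverse[h hK Kh].
have hI : injective h := can_inj Kh.
have hfS : ~ surj (h \o f).
  by move=> S; apply: fS => y; have [x /hI<-] := S (h y); exists x.
have [u _ uK] := sub1_nonsurj_bij hfS; apply: gS => y.
exists (u (h y)); apply: hI; rewrite -[RHS]uK /=; apply/eqP.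
rewrite eq_sym subr_eq addrC -linearD.
by rewrite [X in _ == h X](_ : _ = (f \+ g) (u (h y))) ?hK.
Qed.

(* Non-surjective endomorphisms form the radical J of End(M); radspan is J M. *)
Inductive radspan : M -> Prop :=
| radspan0 : radspan 0
| radspanD f x y : ~ surj f -> radspan y -> radspan (f x + y).

Lemma radspan_add x y : radspan x -> radspan y -> radspan (x + y).
Proof.
elim=> [|f z u fS _ IH] yS; first by rewrite add0r.
by rewrite -addrA; apply: radspanD => //; apply: IH.
Qed.

(** The coefficients stay in J: the image of [f \o c i] lies in that of [f], and J is closed under
    sums by [nonsurj_add]. *)
Lemma radspan_gens n (v : 'I_n -> M) :
  (forall x, exists c : 'I_n -> {linear M -> M}, x = \sum_i c i (v i)) ->
  forall x, radspan x ->
  exists2 c : 'I_n -> {linear M -> M},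
    forall i, ~ surj (c i) & x = \sum_i c i (v i).
Proof.
move=> vP x; elim=> {x} [|f x y fS _ [d dS ->]].
  exists (fun=> \0); last by rewrite big1.
  by move=> i S; have [z /esym] := S x0.
have [c ->] := vP x; exists (fun i => (f \o c i) \+ d i).
  move=> i; apply: nonsurj_add => // S; apply: fS => z.
  by have [u <-] := S z; exists (c i u).
by rewrite linear_sum -big_split.
Qed.

(* Nakayama's lemma over the local ring End(M). *)
Lemma radspan_proper n (v : 'I_n -> M) :
  (forall x, exists c : 'I_n -> {linear M -> M}, x = \sum_i c i (v i)) ->
  ~ (forall x, radspan x).
Proof.
elim: n v => [|n IH] v vP rad; first by case: (vP x0) => c; rewrite big_ord0.
have [c cS] := radspan_gens vP (rad (v ord0)); rewrite big_ord_recl => E.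
have [u uK _] := linear_inverse (sub1_nonsurj_bij (cS ord0)).
have {}E : v ord0 = \sum_(i < n) u (c (lift ord0 i) (v (lift ord0 i))).
  by rewrite -linear_sum -[LHS]uK /= {1}E addrC addKr.
apply: (IH (fun i => v (lift ord0 i))) => // x; have [d ->] := vP x.
exists (fun i => (d ord0 \o (u \o c (lift ord0 i))) \+ d (lift ord0 i)).
by rewrite big_ord_recl [in LHS]E linear_sum -big_split.
Qed.

End LocalEndomorphisms.

(** * Coordinates on finite-dimensional vector spaces *)

Section Coordinates.
Variable k : fieldType.

Lemma rV_bij_dim m n (f : {linear 'rV[k]_m -> 'rV[k]_n}) : bijective f -> m = n.
Proof.
case/linear_inverse=> g fK gK; apply/eqP; rewrite eqn_leq; apply/andP; split.
  apply: (@mulmx1_min k _ _ (lin1_mx f) (lin1_mx g)); apply/row_matrixP => i.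
  by rewrite !rowE mulmxA !mul_rV_lin1 fK mulmx1.
apply: (@mulmx1_min k _ _ (lin1_mx g) (lin1_mx f)); apply/row_matrixP => i.
by rewrite !rowE mulmxA !mul_rV_lin1 gK mulmx1.
Qed.

(** A kernel vector [w] with [w 0 i != 0] makes coordinate [i] redundant: subtracting a multiple of
    [w] clears it without changing the value of [f], which lowers [n]. *)
Lemma rV_surj_bij (V : lmodType k) n (f : {linear 'rV[k]_n -> V}) :
  (forall x, exists v, f v = x) ->
  exists d (g : {linear 'rV[k]_d -> V}), bijective g.
Proof.
elim: n f => [|n IH] f fS.
  exists 0%N, f; apply: inj_surj_bij => // u v _.
  by rewrite (thinmx0 u) (thinmx0 v).
have [fI|] := pselect (injective f).
  by exists n.+1, f; apply: inj_surj_bij.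
case/existsNP=> u /existsNP[v /not_implyP[fuv uv]].
have [i wi0] : exists i, (u - v) 0 i != 0.
  apply/existsP; apply: contra_notT uv => /existsPn w0.
  apply/subr0_eq/rowP => i.
  by rewrite [RHS]mxE; apply/eqP/negbNE/w0.
move: (u - v) wi0 (linearB f u v : f (u - v) = f u - f v) => w wi0.
rewrite fuv subrr => fw0 {u v fuv uv}.
(* Right multiplication by [row' i 1%:M] inserts a zero at position [i]. *)
apply: (IH (f \o mulmxr (row' i 1%:M))) => x; have [u <-] := fS x.
pose u' := u - (u 0 i / w 0 i) *: w.
exists (col' i u'); rewrite /=.
have -> : col' i u' *m row' i 1%:M = u'.
  apply/rowP => j; rewrite mxE; case: (unliftP i j) => [l|] ->.
    rewrite (bigD1 l) //= big1 => [|h hl]; rewrite !mxE.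
      by rewrite eqxx mulr1 addr0.
    by rewrite (inj_eq lift_inj) (negPf hl) mulr0.
  rewrite big1 ?mxE => [|h _]; last first.
    by rewrite !mxE eq_sym (negPf (neq_lift _ _)) mulr0.
  by rewrite divfK // subrr.
by rewrite linearB linearZ /= fw0 scaler0 subr0.
Qed.

Lemma span_coordinates (V : lmodType k) (I : finType) (g : I -> V) :
  (forall x, exists c : I -> k, x = \sum_i c i *: g i) ->
  exists d (f : {linear 'rV[k]_d -> V}), bijective f.
Proof.
move=> gP; pose f (v : 'rV[k]_#|I|) := \sum_i v 0 (enum_rank i) *: g i.
have lf : linear f.
  move=> a x y; rewrite scaler_sumr -big_split; apply: eq_bigr => i _.
  by rewrite !mxE scalerDl scalerA.
pose F := GRing.isLinear.Build _ _ V _ f lf.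
pose h : {linear 'rV[k]_#|I| -> V} := HB.pack f F.
apply: (@rV_surj_bij V #|I| h) => x; have [c ->] := gP x.
exists (\row_i c (enum_val i)); apply: eq_bigr => i _.
by rewrite mxE enum_rankK.
Qed.

End Coordinates.

(** * Modules as vector spaces over k *)

Section FiniteDimensional.
Variables (k : fieldType) (A : falgType k).

Let mulcE (a b : A^c) : a * b = (b : A) * (a : A) :> A.
Proof. by []. Qed.

Section BaseField.
Variable M : rmodType A.

(** An alias of [M], so that scaling by [k] through [c%:A] does not clash with the [A^c]-module
    structure. *)
Definition kmod : Type := M.
HB.instance Definition _ := GRing.Zmodule.on kmod.

Let kscale (c : k) (x : M) : M := (c%:A : A^c) *: x.

Fact kscaleA a b (x : kmod) : kscale a (kscale b x) = kscale (a * b) x.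
Proof.
rewrite /kscale scalerA; congr (_ *: _).
by rewrite mulcE mulr_algl scalerA mulrC.
Qed.
Fact kscale1 : left_id 1 (kscale : k -> kmod -> kmod).
Proof. by move=> x; rewrite /kscale scale1r scale1r. Qed.
Fact kscaleDr : right_distributive (kscale : k -> kmod -> kmod) +%R.
Proof. by move=> a x y; rewrite /kscale scalerDr. Qed.
Fact kscaleDl x : {morph (kscale^~ x : k -> kmod) : a b / a + b}.
Proof. by move=> a b; rewrite /kscale !scalerDl. Qed.
HB.instance Definition _ :=
  GRing.Zmodule_isLmodule.Build k kmod kscaleA kscale1 kscaleDr kscaleDl.

Lemma kmodZE (c : k) (x : kmod) : c *: x = (c%:A : A^c) *: (x : M).
Proof. by []. Qed.

(** Scalars are central in [A]. Hence scaling by [k] is [A]-linear and the action of [A] is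
    [k]-linear; both readings are used. *)
Lemma alg_scaleC (c : k) (a : A^c) (x : M) :
  (c%:A : A^c) *: (a *: x) = a *: ((c%:A : A^c) *: x).
Proof.
rewrite !scalerA; congr (_ *: _).
by rewrite !mulcE mulr_algl mulr_algr.
Qed.

End BaseField.

Lemma kmod_linear (M N : rmodType A) (f : {linear M -> N}) :
  exists g : {linear kmod M -> kmod N}, g =1 f.
Proof.
have lf : linear (f : kmod M -> kmod N).
  by move=> a x y; rewrite !kmodZE linearP.
pose F := GRing.isLinear.Build _ (kmod M) (kmod N) _ f lf.
pose g : {linear kmod M -> kmod N} := HB.pack (f : kmod M -> kmod N) F.
by exists g.
Qed.

(** The products of a [k]-basis of [A] with the generators span [M] over [k]. *)
Lemma fingen_coordinates (M : rmodType A) : fingen M ->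
  exists d (f : {linear 'rV[k]_d -> kmod M}), bijective f.
Proof.
case=> n [g gP]; pose b := vbasis {:A}.
pose h (ij : 'I_n * 'I_(\dim {:A})) : kmod M := (b`_ij.2 : A^c) *: g ij.1.
apply: (@span_coordinates k _ _ h) => x; have [c ->] := gP x.
exists (fun ij => coord b ij.2 (c ij.1)).
rewrite -(pair_bigA _ (fun i j => coord b j (c i) *: h (i, j))) /=.
apply: eq_bigr => i _.
rewrite [X in (X : A^c) *: _](coord_vbasis (memvf (c i))) scaler_suml.
apply: eq_bigr => j _; rewrite kmodZE /h /= scalerA.
apply: (congr1 (fun a : A^c => a *: g i)).
by rewrite mulcE mulr_algr.
Qed.

End FiniteDimensional.

(** * Fitting's lemma for indecomposable modules *)

(** Stated through idempotents, as both Fitting's lemma and the splitting into summands use it; the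
    zero module satisfies it. *)
Definition indecomposable (R : pzRingType) (M : lmodType R) : Prop :=
  forall e : {linear M -> M}, (forall x, e (e x) = e x) ->
    (forall x, e x = 0) \/ (forall x, e x = x).

(* Writing the characteristic polynomial of an endomorphism as q X^m with
   q(0) != 0, a Bezout relation u X^m + v q = 1 yields the idempotent v q. *)
Lemma indecomposable_fitting (k : fieldType) (A : falgType k) (M : rmodType A) d
    (phi : {linear 'rV[k]_d -> kmod M}) :
  bijective phi -> indecomposable M -> forall f : {linear M -> M},
  bijective f \/ exists n, forall x, iter n f x = 0.
Proof.
move=> phi_bij indM f; have [psi phiK psiK] := linear_inverse phi_bij.
(* The zero module is treated apart, so that the matrices below have size [d.+1]. *)
case: d => [|d] in phi phi_bij psi phiK psiK *.
  have M0 (x y : kmod M) : x = y.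
    by rewrite -[x]psiK -[y]psiK [psi x]thinmx0 [psi y]thinmx0.
  by left; exists id => x; apply: M0.
pose mx (g : {linear kmod M -> kmod M}) := lin1_mx (psi \o g \o phi).
have mxE (g : {linear kmod M -> kmod M}) x : psi (g x) = psi x *m mx g.
  by rewrite mul_rV_lin1 /= psiK.
have psi_inj : injective psi := can_inj psiK.
have phi_inj : injective phi := can_inj phiK.
have [fk fkE] := kmod_linear f; pose F := mx fk.
have FE x : psi (f x) = psi x *m F by rewrite -mxE fkE.
have iterE n x : psi (iter n f x) = psi x *m F ^+ n.
  elim: n => [|n IH] /=; first by rewrite mulmx1.
  by rewrite FE IH exprSr mulmxA.
(* [F] commutes with the matrices of the action of [A], hence so does every polynomial in [F], which
   therefore comes from an [A]-endomorphism. *)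
have hornerP p : exists e : {linear M -> M},
    forall x, psi (e x) = psi x *m horner_mx F p.
  pose h (x : M) : M := phi (psi x *m horner_mx F p).
  have [|e eE] := @linear_pack A M M h; last by exists e => x; rewrite eE phiK.
  have hZ a x : h (a *: x) = a *: h x.
    pose l (x : kmod M) : kmod M := a *: (x : M).
    have la : linear l.
      by move=> c y z; rewrite /l !kmodZE scalerDr alg_scaleC.
    pose Fa := GRing.isLinear.Build _ (kmod M) (kmod M) _ _ la.
    pose g : {linear kmod M -> kmod M} := HB.pack l Fa.
    have gF : comm_mx (mx g) F.
      apply/row_matrixP => i; rewrite !rowE -[delta_mx _ _]phiK !mulmxA.
      by rewrite -!mxE !fkE /= linearZ.
    rewrite /h -[a *: x]/(g x) mxE -mulmxA (comm_mx_horner p gF) mulmxA.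
    by apply: psi_inj; rewrite phiK -[a *: _]/(g (phi _)) mxE phiK.
  move=> a x y; rewrite -hZ /h -linearD -mulmxDl; congr (phi (_ *m _)).
  by rewrite -linearD.
have [m [q qN0 cpE]] := multiplicity_XsubC (char_poly F) 0.
(* A positive exponent, even when [m = 0], lets bijectivity of [iter n f] pass to [f]. *)
pose n := m.+1.
have cop : coprimep ('X ^+ n) q.
  rewrite coprimep_sym; apply: coprimep_expr.
  rewrite -['X]subr0 -polyC0 coprimep_XsubC.
  by apply: (implyP qN0); apply/monic_neq0/char_poly_monic.
have [[u v] /= uv1] := Bezout_eq1_coprimepP _ _ cop.
have q0 : horner_mx F q *m F ^+ n = 0.
  have := Cayley_Hamilton F.
  rewrite cpE polyC0 subr0 rmorphM rmorphXn /= horner_mx_X -mulmxE.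
  by rewrite /n exprSr mulmxA => ->; rewrite mul0mx.
have comm p r : horner_mx F p *m horner_mx F r = horner_mx F r *m horner_mx F p.
  by rewrite !mulmxE -!rmorphM mulrC.
have XmE : horner_mx F ('X ^+ n) = F ^+ n by rewrite rmorphXn /= horner_mx_X.
have {}uv1 : horner_mx F u *m F ^+ n + horner_mx F (v * q) = 1%:M.
  by rewrite -XmE mulmxE -rmorphM -rmorphD uv1 rmorph1.
have vqF : horner_mx F (v * q) *m F ^+ n = 0.
  by rewrite rmorphM /= -!mulmxE -mulmxA q0 mulmx0.
have idem : horner_mx F (v * q) *m horner_mx F (v * q) = horner_mx F (v * q).
  rewrite -[in RHS](mul1mx (horner_mx F (v * q))) -uv1 mulmxDl -mulmxA.
  by rewrite -XmE comm XmE vqF mulmx0 add0r.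
have [e eE] := hornerP (v * q).
(* If [e = 0], the Bezout relation makes [horner_mx F u] an inverse of [F ^+ n]; if [e = 1], then
   [F ^+ n = 0]. *)
have [x|e0|e1] := indM e.
- by apply: psi_inj; rewrite !eE -mulmxA idem.
- have [w wE] := hornerP u.
  have uF : horner_mx F u *m F ^+ n = 1%:M.
    rewrite -uv1 -[LHS]addr0; congr (_ + _); apply/esym/row_matrixP => i.
    by rewrite rowE -[delta_mx _ _]phiK -eE e0 linear0 row0.
  have Fu : F ^+ n *m horner_mx F u = 1%:M by rewrite -XmE comm XmE.
  left; have [g fK gK] : bijective (iter n f).
    exists w => x; apply: psi_inj; first by rewrite wE iterE -mulmxA Fu mulmx1.
    by rewrite iterE wE -mulmxA uF mulmx1.
  apply: inj_surj_bij => [x y fxy|y]; last first.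
    by exists (iter m f (g y)); rewrite -[LHS]/(iter n f _) gK.
  by apply: (can_inj fK); rewrite /n !iterSr fxy.
- right; exists n => x; apply: psi_inj; rewrite linear0 iterE.
  by rewrite -[in LHS](e1 x) eE -mulmxA vqF mulmx0.
Qed.

(** * Direct sums, closure of [addm], and maps from sums into a module *)

Section Modules.
Variable A : pzRingType.
Implicit Types (M N P Q : rmodType A) (S : module_class A).

Lemma is_isomorphic_trans M N P :
  is_isomorphic M N -> is_isomorphic N P -> is_isomorphic M P.
Proof. by case=> f fB [g gB]; exists (g \o f); apply: bij_comp. Qed.

Lemma is_isomorphic_sum M M' N N' : is_isomorphic M M' -> is_isomorphic N N' ->
  is_isomorphic (direct_sum2 M N) (direct_sum2 M' N').
Proof.
case=> f [f' fK f'K] [g [g' gK g'K]].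
have [|h hE] := @linear_pack A (direct_sum2 M N) (direct_sum2 M' N')
  (fun z => (f z.1, g z.2)).
  by move=> a [x1 x2] [y1 y2]; rewrite /= !linearP.
exists h; exists (fun z => (f' z.1, g' z.2)) => -[x y]; rewrite hE /=.
  by rewrite fK gK.
by rewrite f'K g'K.
Qed.

Lemma is_isomorphic_sumA M N P :
  is_isomorphic (direct_sum2 M (direct_sum2 N P))
                (direct_sum2 (direct_sum2 M N) P).
Proof.
have [//|h hE] := @linear_pack A (direct_sum2 M (direct_sum2 N P))
    (direct_sum2 (direct_sum2 M N) P) (fun z => ((z.1, z.2.1), z.2.2)).
exists h; exists (fun z => (z.1.1, (z.1.2, z.2))).
  by case=> x [y z]; rewrite hE.
by case=> -[x y] z; rewrite hE.
Qed.

Lemma is_isomorphic_0sum M :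
  is_isomorphic M (direct_sum2 (zero_module A) M).
Proof.
have [|h hE] := @linear_pack A M (direct_sum2 (zero_module A) M)
    (fun x => (0, x)).
  by move=> a x y; congr pair; rewrite [RHS](thinmx0 _).
exists h; exists snd => [x|[z x]]; rewrite hE //.
by rewrite (thinmx0 z).
Qed.

Lemma is_isomorphic_sum0 M :
  is_isomorphic (direct_sum2 M (zero_module A)) M.
Proof.
have [//|h hE] := @linear_pack A (direct_sum2 M (zero_module A)) M fst.
exists h; exists (fun x => (x, 0)) => [[x z]|x]; rewrite hE //.
by rewrite (thinmx0 z).
Qed.

Lemma is_quotient_proj2 M N : is_quotient (direct_sum2 M N) N.
Proof.
have [//|h hE] := @linear_pack A (direct_sum2 M N) N snd.
by exists h => x; exists (0, x); rewrite hE.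
Qed.

Lemma is_isomorphic_sym M N : is_isomorphic M N -> is_isomorphic N M.
Proof. by case=> f /linear_inverse[g fK gK]; exists g; exists f. Qed.

Lemma sub_addm S : subclass S (addm S).
Proof.
move=> M SM; exists (direct_sum2 M (zero_module A)).
  by constructor => //; constructor.
exact: is_isomorphic_sum0.
Qed.

Lemma addm_sub_Gen S : subclass (addm S) (Gen S).
Proof. by move=> M [N SN /is_isomorphic_quotient NM]; exists N. Qed.

Lemma addm_iso S M N : addm S M -> is_isomorphic M N -> addm S N.
Proof.
by case=> P SP PM MN; exists P => //; apply: is_isomorphic_trans PM MN.
Qed.

Lemma addm_sum S M N : addm S M -> addm S N -> addm S (direct_sum2 M N).
Proof.
case=> P SP PM [Q SQ QN].
apply: addm_iso (is_isomorphic_sum PM QN) => {M N PM QN}.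
elim: SP => [|{}M N SM _ [P' SP' P'N]].
  by exists Q => //; apply: is_isomorphic_0sum.
exists (direct_sum2 M P'); first by constructor.
apply: is_isomorphic_trans (is_isomorphic_sumA _ _ _).
apply: is_isomorphic_sum P'N; by exists idfun; exists id.
Qed.

Lemma linear_sum2 M N P (f : {linear direct_sum2 M N -> P}) :
  exists (f1 : {linear M -> P}) (f2 : {linear N -> P}),
    forall x y, f (x, y) = f1 x + f2 y.
Proof.
have [|i1 i1E] := @linear_pack A M (direct_sum2 M N) (fun x => (x, 0)).
  by move=> a x y; congr pair; rewrite /= scaler0 addr0.
have [|i2 i2E] := @linear_pack A N (direct_sum2 M N) (fun x => (0, x)).
  by move=> a x y; congr pair; rewrite /= scaler0 addr0.
exists (f \o i1), (f \o i2) => x y; rewrite /= -linearD i1E i2E.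
by congr (f (_, _)); rewrite ?addr0 ?add0r.
Qed.

(** On a power of [M] the components of [f] are endomorphisms of [M] with images inside that of [f],
    so none is surjective. *)
Lemma nonsurj_power_radspan M N (f : {linear N -> M}) :
  direct_sum (fun P => P = M) N -> ~ surj f -> forall x, radspan (f x).
Proof.
move=> MN; elim: MN f => [|P {}N -> _ IH] f fS.
  by move=> x; rewrite (thinmx0 x) linear0; constructor.
have [f1 [f2 fE]] := linear_sum2 f; case=> x y; rewrite fE.
apply: radspanD => [S'|].
  apply: fS => z; have [u <-] := S' z.
  by exists (u, 0); rewrite fE linear0 addr0.
apply: IH => S'; apply: fS => z; have [u <-] := S' z.
by exists (0, u); rewrite fE linear0 add0r.
Qed.

(** Each summand [P] is covered by a power of [M], and a map from [P] to [M], never surjective,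
    stays so after composing with this cover; [nonsurj_power_radspan] then applies. *)
Lemma nonsurj_sum_radspan S M N (f : {linear N -> M}) :
  (forall P, S P -> Gen (fun Q => Q = M) P /\ ~ is_quotient P M) ->
  direct_sum S N -> forall x, radspan (f x).
Proof.
move=> SP SN; elim: SN f => [|P {}N /SP[[Q MQ [g gS]] PM] _ IH] f.
  by move=> x; rewrite (thinmx0 x) linear0; constructor.
have [f1 [f2 fE]] := linear_sum2 f; case=> x y; rewrite fE.
apply: radspan_add => //; have [z <-] := gS x.
apply: (@nonsurj_power_radspan M Q (f1 \o g)) => // S'.
apply: PM; exists f1 => u.
by have [v <-] := S' u; exists (g v).
Qed.

End Modules.

(** * Distributivity and the equality of [addm] and [Gen] *)

Section FiniteDimensionalModules.
Variables (k : fieldType) (A : falgType k).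
Implicit Types M N : rmodType A.

(** Scalings by [k] are [A]-endomorphisms, so a [k]-basis generates [M] over End(M), as
    [radspan_proper] requires. *)
Lemma kmod_endo_span M d (phi : {linear 'rV[k]_d -> kmod M}) : bijective phi ->
  forall x : M, exists c : 'I_d -> {linear M -> M},
    x = \sum_i c i (phi (delta_mx 0 i)).
Proof.
case/linear_inverse=> psi _ psiK x.
have scal (a : k) : exists f : {linear M -> M},
    forall y, f y = (a%:A : A^c) *: y.
  apply: linear_pack => b y z.
  by rewrite scalerDr alg_scaleC.
have [c cE] := choice scal; exists (fun i => c (psi x 0 i)).
rewrite -[LHS]psiK [psi x in LHS]row_sum_delta linear_sum.
apply: eq_bigr => i _.
by rewrite cE linearZ.
Qed.

(** Additivity of dimension, the dimension being the size of a coordinate isomorphism. *)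
Lemma coordinates_sum M N P m n p (f : {linear 'rV[k]_m -> kmod M})
    (g : {linear 'rV[k]_n -> kmod N}) (h : {linear 'rV[k]_p -> kmod P}) :
  bijective f -> bijective g -> bijective h ->
  is_isomorphic (direct_sum2 M N) P -> (m + n)%N = p.
Proof.
case=> f' fK f'K [g' gK g'K] /linear_inverse[h' hK h'K] [i [i' iK i'K]].
have [ik ikE] := kmod_linear i.
pose t (u : 'rV[k]_(m + n)) : 'rV[k]_p :=
  h' (ik ((f (lsubmx u), g (rsubmx u)) : kmod (direct_sum2 M N))).
have lt : linear t.
  by move=> a x y; rewrite /t -!linearP; congr (h' (ik _)); rewrite !linearP.
pose F := GRing.isLinear.Build _ _ _ _ t lt.
pose T : {linear 'rV[k]_(m + n) -> 'rV[k]_p} := HB.pack t F.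
apply: (rV_bij_dim (f := T)).
exists (fun v => row_mx (f' (i' (h v)).1) (g' (i' (h v)).2)) => u.
  by rewrite /= /t h'K ikE iK /= fK gK hsubmxK.
by rewrite /= /t row_mxKl row_mxKr f'K g'K ikE -surjective_pairing i'K hK.
Qed.

Lemma coordinates_gt0 M d (f : {linear 'rV[k]_d -> kmod M}) (x : M) :
  bijective f -> x <> 0 -> (0 < d)%N.
Proof.
case: d f => // f [g _ gK]; case.
by rewrite -[LHS](gK x) (thinmx0 (g x)) linear0.
Qed.

Lemma distributive_indecomposable (T1 T2 : pretorsion A) M :
  left_distributive (@pretorsion_meet A) (@pretorsion_join A) ->
  indecomposable M -> Gen (unionclass T1 T2) M -> unionclass T1 T2 M.
Proof.
move=> distr indM M12; apply: contrapT => nM12.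
have T12 := pretorsionP (pretorsion_join T1 T2).
have Mfg := pretorsion_fingen T12 M12.
have [d [phi phiB]] := fingen_coordinates Mfg.
have fit := indecomposable_fitting phiB indM.
(* The zero module lies in every pretorsion class, so [M] is nonzero. *)
have [x0 x0N0] : exists x : M, x <> 0.
  apply: contrapT => /forallNP M0; apply: nM12; left.
  have T1P := pretorsionP T1.
  apply: (pretorsion_quotient T1P (pretorsion_zero T1P)).
  by exists \0 => y; exists 0; rewrite (contrapT (M0 y)).
have genM_fg : subclass (fun N => N = M) (@fingen A) by move=> _ ->.
pose T3 := Pretorsion (Gen_pretorsion genM_fg).
(* Distributivity turns this into a surjection onto [M] from a finite sum of modules of [T1] or [T2]
   that are themselves generated by [M]. *)
have : pretorsion_class (pretorsion_meet (pretorsion_join T1 T2) T3) M.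
  by split => //; apply: sub_Gen.
rewrite distr => -[N SN [f fS]].
apply: (radspan_proper fit x0N0 (kmod_endo_span phiB)) => x.
have [y <-] := fS x; apply: nonsurj_sum_radspan SN _ => P SP.
(* A surjection from [P] onto [M] would put [M] in [T1] or [T2]. *)
split=> [|PM]; first by case: SP => -[].
by apply: nM12; case: SP => -[TP _]; [left|right];
  apply: pretorsion_quotient PM => //; apply: pretorsionP.
Qed.

Lemma distributive_addm (T1 T2 : pretorsion A) M :
  left_distributive (@pretorsion_meet A) (@pretorsion_join A) ->
  Gen (unionclass T1 T2) M -> addm (unionclass T1 T2) M.
Proof.
move=> distr M12; have T12 := pretorsionP (pretorsion_join T1 T2).
have [d [phi phiB]] := fingen_coordinates (pretorsion_fingen T12 M12).
elim/ltn_ind: d => d IH in M phi phiB M12 *.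
have [indM|] := pselect (indecomposable M).
  by apply: sub_addm; apply: distributive_indecomposable.
case/existsNP=> e /not_implyP[e_idem /not_orP[]].
move=> /existsNP[x ex0] /existsNP[y ey].
have [f fB] := idempotent_split e_idem; set e' := idfun \- e in f fB.
pose P : rmodType A := fixed_sub e; pose Q : rmodType A := fixed_sub e'.
have PQM : is_isomorphic (direct_sum2 P Q) M by exists f.
have MPQ := is_isomorphic_quotient (is_isomorphic_sym PQM).
(* Both summands are quotients of [M], so they stay in the join. *)
have P12 : Gen (unionclass T1 T2) P.
  apply: pretorsion_quotient T12 _ _ M12 _.
  exact: is_quotient_trans MPQ (is_quotient_proj1 _ _).
have Q12 : Gen (unionclass T1 T2) Q.
  apply: pretorsion_quotient T12 _ _ M12 _.
  exact: is_quotient_trans MPQ (is_quotient_proj2 _ _).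
have [p [g gB]] := fingen_coordinates (pretorsion_fingen T12 P12).
have [q [h hB]] := fingen_coordinates (pretorsion_fingen T12 Q12).
have pqd := coordinates_sum gB hB phiB PQM.
(* The elements [e x] and [y - e y] show that both summands are nonzero, so each has dimension below
   [d]. *)
have exP : e x \in fixed e by rewrite inE e_idem.
have eyQ : e' y \in fixed e' by rewrite inE /= linearB /= e_idem subrr subr0.
have p_gt0 : (0 < p)%N.
  apply: (coordinates_gt0 (x := (Sub (e x) exP : P)) gB) => /(congr1 val).
  by rewrite SubK.
have q_gt0 : (0 < q)%N.
  apply: (coordinates_gt0 (x := (Sub (e' y) eyQ : Q)) hB) => /(congr1 val).
  by rewrite SubK /= => /subr0_eq/esym.
apply: addm_iso PQM; apply: addm_sum.
  by apply: IH gB P12; rewrite -pqd -addn1 leq_add2l.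
by apply: IH hB Q12; rewrite -pqd -add1n leq_add2r.
Qed.

Lemma addm_distributive :
  (forall T1 T2 : pretorsion A,
    addm (unionclass T1 T2) = Gen (unionclass T1 T2)) ->
  left_distributive (@pretorsion_meet A) (@pretorsion_join A).
Proof.
move=> addE T1 T2 T3; apply: pretorsion_anti; last first.
  (* This inclusion holds in every lattice. *)
  apply/pretorsion_joinP; split=> M [TM T3M]; split=> //; apply: sub_Gen.
    by left.
  by right.
move=> M [/= M12 M3].
have [N SN NM] : addm (unionclass T1 T2) M by rewrite addE.
have {M3}N3 : pretorsion_class T3 N.
  apply: pretorsion_quotient M3 _; first exact: pretorsionP.
  exact/is_isomorphic_quotient/is_isomorphic_sym.
exists N; last exact: is_isomorphic_quotient.
(* The first summand and the remaining sum are both quotients of the whole, so membership in [T3]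
   passes to each. *)
elim: SN N3 => [|{NM M12}M P SM _ IH] N3; first by constructor.
have T3q := pretorsion_quotient (pretorsionP T3) N3.
constructor; last by apply: IH; apply: T3q; apply: is_quotient_proj2.
have M3 : pretorsion_class T3 M by apply: T3q; apply: is_quotient_proj1.
by case: SM => TM; [left|right].
Qed.

End FiniteDimensionalModules.

Theorem theorem4p4 (k : closedFieldType) (A : falgType k) :
  left_distributive (@pretorsion_meet A) (@pretorsion_join A) <->
  (forall T1 T2 : pretorsion A, addm (unionclass T1 T2) = Gen (unionclass T1 T2)).
Proof.
split=> [distr T1 T2|]; last exact: addm_distributive.
apply: funext => M; apply: propext; split; first exact: addm_sub_Gen.
exact: distributive_addm.
Qed.
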